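(* Let $a\le -1$ be an integer. Define $a_{\mathcal{G}}(n)$, $n\ge0$, by $a_{\mathcal{G}}(0)=1$, $a_{\mathcal{G}}(1)=-1$, $a_{\mathcal{G}}(2)=a$ and, for $n\ge3$, $$a_{\mathcal{G}}(n)=-\frac12\left(\sum_{k=0}^{n-2}a_{\mathcal{G}}(k)\binom{n-1}{k}2^{n-1-k}+\sum_{k=0}^{n-1}a_{\mathcal{G}}(k)\binom{n}{k}2^{n-k}\right).$$ For integers $0\le j\le d$ set $c_{\mathcal{G}}(j,d)=\sum_{k=j}^d2^{-k}\binom{d-j}{d-k}a_{\mathcal{G}}(k)$. Then for all $m\ge1$: $$0\le c_{\mathcal{G}}(0,4m)\le c_{\mathcal{G}}(1,4m)\le\cdots\le c_{\mathcal{G}}(2m,4m),$$ $$0\le c_{\mathcal{G}}(2m,4m+1)\le c_{\mathcal{G}}(2m-1,4m+1)\le\cdots\le c_{\mathcal{G}}(0,4m+1),$$ $$0\ge c_{\mathcal{G}}(0,4m+2)\ge c_{\mathcal{G}}(1,4m+2)\ge\cdots\ge c_{\mathcal{G}}(2m+1,4m+2),$$ $$0\ge c_{\mathcal{G}}(2m+1,4m+3)\ge c_{\mathcal{G}}(2m,4m+3)\ge\cdots\ge c_{\mathcal{G}}(0,4m+3).$$ *)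

(* Defs.v *)
From mathcomp Require Import all_boot all_order all_algebra.

Set Implicit Arguments.
Unset Strict Implicit.
Unset Printing Implicit Defensive.

Import Order.TTheory GRing.Theory Num.Theory.

Local Open Scope ring_scope.

Definition aG_next (a : int) (u : nat -> rat) (n : nat) : rat :=
  match n with
  | 0 => 1
  | 1 => -1
  | 2 => a%:~R
  | _ => - (1 / 2) *
         (\sum_(0 <= k < n.-1) u k * 'C(n.-1, k)%:R * 2 ^+ (n.-1 - k)
          + \sum_(0 <= k < n) u k * 'C(n, k)%:R * 2 ^+ (n - k))
  end.

(* Course-of-values recursion: the list of the first n terms of the sequence.
   The lemmas below give the equations that characterize aG. *)
Fixpoint aG_list (a : int) (n : nat) : seq rat :=
  if n is n'.+1 then
    let s := aG_list a n' in rcons s (aG_next a (nth 0 s) n')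
  else [::].

Definition aG (a : int) (n : nat) : rat := (aG_list a n.+1)`_n.

Definition cG (a : int) (j d : nat) : rat :=
  \sum_(j <= k < d.+1) 2 ^- k * 'C(d - j, d - k)%:R * aG a k.

Lemma size_aG_list a n : size (aG_list a n) = n.
Proof. by elim: n => //= n IHn; rewrite size_rcons IHn. Qed.

Lemma nth_aG_list a n k : (k < n)%N -> (aG_list a n)`_k = aG a k.
Proof.
elim: n => // n IHn; rewrite ltnS leq_eqVlt => /predU1P[-> //|lt_kn].
by rewrite /= nth_rcons size_aG_list lt_kn IHn.
Qed.

Lemma aGE a n : aG a n = aG_next a (nth 0 (aG_list a n)) n.
Proof. by rewrite /aG /= nth_rcons size_aG_list ltnn eqxx. Qed.

Lemma aG0 a : aG a 0 = 1.
Proof. by []. Qed.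

Lemma aG1 a : aG a 1 = -1.
Proof. by []. Qed.

Lemma aG2 a : aG a 2 = a%:~R.
Proof. by []. Qed.

Lemma aG_rec a n : (3 <= n)%N ->
  aG a n = - (1 / 2) *
    (\sum_(0 <= k < n.-1) aG a k * 'C(n.-1, k)%:R * 2 ^+ (n.-1 - k)
     + \sum_(0 <= k < n) aG a k * 'C(n, k)%:R * 2 ^+ (n - k)).
Proof.
case: n => [|[|[|n]]] // _; rewrite aGE [LHS]/aG_next.
by congr (_ * (_ + _)); apply: eq_big_nat => k /andP[_ ltk];
  rewrite nth_aG_list // ltnW.
Qed.

(* Main.v *)
Require Import Defs.
From mathcomp Require Import all_boot all_order all_algebra.
From mathcomp Require Import ring lra zify.

(** Since [cG j d = cG j d.-1 + cG j.+1 d], the monotonicity of a row is the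
    sign of the previous one. In terms of the [cG j d], the recurrence defining
    [aG] reads [2 (cG n n + cG 0 n) = cG n.-1 n.-1 - cG 0 n.-1], which forces
    [cG (d - j) d = (-1)^d cG j d] for [j <= d]. By this symmetry, the middle
    entry of an odd row is half the middle entry of the previous row, and the
    first entry of an even row is [-1/2] times the first entry of the previous
    row (from row 4 on; row 2 starts with [a / 4]). From these entries the
    triangle rule propagates signs through the left half of each row: leftwards
    in odd rows, rightwards in even ones. *)

Set Implicit Arguments.
Unset Strict Implicit.
Unset Printing Implicit Defensive.

Import Order.TTheory GRing.Theory Num.Theory.

Local Open Scope ring_scope.

Definition pascal_rule (V : nmodType) (c : nat -> nat -> V) : Prop :=
  forall j d, (j <= d)%N -> c j d.+1 = c j d + c j.+1 d.+1.

Lemma pascal_rule_binomial_sum (V : nmodType) (b : nat -> V) :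
  pascal_rule (fun j d => \sum_(j <= k < d.+1) b k *+ 'C(d - j, d - k)).
Proof.
move=> j d le_jd; rewrite big_nat_recr ?leqW //= subnn bin0.
rewrite [X in _ = _ + X]big_nat_recr //= subnn bin0 addrA; congr (_ + _).
have -> : \sum_(j.+1 <= k < d.+1) b k *+ 'C(d.+1 - j.+1, d.+1 - k)
    = \sum_(j <= k < d.+1) b k *+ 'C(d - j, d.+1 - k).
  by rewrite [RHS]big_ltn // bin_small ?mulr0n ?add0r // subSn.
rewrite -big_split; apply: eq_big_nat => k /andP[_ lt_kd].
by rewrite !subSn // binS mulrnDr addrC.
Qed.

Section PascalOrder.

Variables (R : numDomainType) (c : nat -> nat -> R).
Hypothesis pascal : pascal_rule c.

Lemma pascal_row_ge j d : (j <= d)%N ->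
  (c j.+1 d.+1 <= c j d.+1) = (0 <= c j d).
Proof. by move=> /pascal ->; rewrite lerDr. Qed.

Lemma pascal_row_le j d : (j <= d)%N ->
  (c j d.+1 <= c j.+1 d.+1) = (c j d <= 0).
Proof. by move=> /pascal ->; rewrite gerDr. Qed.

End PascalOrder.

Definition row_symmetric (R : pzRingType) (c : nat -> nat -> R) (s : R)
    (d : nat) : Prop :=
  forall j, (j <= d)%N -> c (d - j)%N d = s * c j d.

Definition parity_symmetric (R : pzRingType) (c : nat -> nat -> R) : Prop :=
  forall d, row_symmetric c ((-1) ^+ d) d.

Section RowSymmetry.

Variables (R : pzRingType) (c : nat -> nat -> R).
Hypothesis pascal : pascal_rule c.

Lemma row_symmetry_defect_const s d j : row_symmetric c s d -> (j <= d.+1)%N ->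
  c (d.+1 - j)%N d.+1 + s * c j d.+1 = c d.+1 d.+1 + s * c 0 d.+1.
Proof.
move=> sym; elim: j => [|j IHj] le_jd; first by rewrite subn0.
rewrite -IHj 1?ltnW // subSS subSn // (pascal (leq_subr j d)) (sym j) //.
by rewrite (pascal (j := j)) // mulrDr addrA [s * _ + _]addrC.
Qed.

Lemma row_symmetricS s d : row_symmetric c s d ->
  c d.+1 d.+1 = - s * c 0 d.+1 -> row_symmetric c (- s) d.+1.
Proof.
move=> sym edge j /(row_symmetry_defect_const sym).
by rewrite edge mulNr addNr mulNr => /eqP; rewrite addr_eq0 => /eqP.
Qed.

End RowSymmetry.

Section ParitySymmetry.

Variables (R : numDomainType) (c : nat -> nat -> R).
Hypothesis pascal : pascal_rule c.

Lemma antisymmetric_row_next_edges d : row_symmetric c (-1) d ->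
  c d.+1 d.+1 = c 0 d.+1.
Proof.
move=> /(row_symmetry_defect_const pascal)/(_ (leqnn d.+1)).
rewrite subnn !mulN1r -opprB => /eqP.
by rewrite eqNr subr_eq0 => /eqP.
Qed.

Lemma parity_symmetric_of_edges :
    (forall d, ~~ odd d -> c d d = c 0 d -> c d.+1 d.+1 = - c 0 d.+1) ->
  parity_symmetric c.
Proof.
move=> odd_edges; elim=> [|d sym].
  by move=> j; rewrite leqn0 => /eqP ->; rewrite mul1r.
rewrite exprS mulN1r; apply: (row_symmetricS pascal) => //.
move: sym; rewrite -signr_odd; case: (boolP (odd d)) => odd_d sym.
  by rewrite opprK mul1r (antisymmetric_row_next_edges sym).
rewrite mulN1r odd_edges //.
by have := sym 0 isT; rewrite subn0 mul1r.
Qed.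

End ParitySymmetry.

Definition left_half_ge0 (R : numDomainType) (c : nat -> nat -> R) (s : R)
    (d : nat) : Prop :=
  forall j, (j <= d./2)%N -> 0 <= s * c j d.

Section Signs.

Variables (R : numDomainType) (c : nat -> nat -> R).
Hypotheses (pascal : pascal_rule c) (symmetric : parity_symmetric c).

Lemma odd_row_middle d : ~~ odd d -> c d./2 d.+1 *+ 2 = c d./2 d.
Proof.
move=> even_d; have le_d2 : (d./2 <= d)%N by lia.
have middle : c d./2.+1 d.+1 = - c d./2 d.+1.
  have <- : (d.+1 - d./2 = d./2.+1)%N by lia.
  by rewrite symmetric 1?ltnW // exprS -signr_odd (negPf even_d) mulr1 mulN1r.
by rewrite mulr2n {1}(pascal le_d2) middle addrNK.
Qed.

Lemma left_half_ge0_odd_row s d : ~~ odd d ->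
  left_half_ge0 c s d -> left_half_ge0 c s d.+1.
Proof.
move=> even_d c_ge0 j; rewrite -uphalfE uphalf_half (negPf even_d) add0n.
move=> /subKn <-; elim: (d./2 - j)%N => [|i IHi].
  by rewrite subn0 -(pmulrn_lge0 _ (n := 2)) // -mulrnAr odd_row_middle ?c_ge0.
have [le_di | lt_id] := leqP d./2 i.
  by have -> : (d./2 - i.+1 = d./2 - i)%N by lia.
rewrite pascal; last by lia.
by rewrite mulrDr addr_ge0 ?c_ge0 ?leq_subr // subnSK.
Qed.

Lemma left_half_ge0_even_row s d : odd d -> left_half_ge0 c s d ->
  0 <= - s * c 0 d.+1 -> left_half_ge0 c (- s) d.+1.
Proof.
move=> odd_d c_ge0 edge_ge0; elim=> // j IHj lt_jd.
have le_jd : (j <= d./2)%N by move: lt_jd; rewrite /= uphalf_half odd_d.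
have -> : c j.+1 d.+1 = c j d.+1 - c j d.
  by rewrite (pascal (j := j)); [rewrite [RHS]addrC addKr | lia].
by rewrite mulrDr mulrNN addr_ge0 ?c_ge0 ?IHj // ltnW.
Qed.

Lemma left_half_sign :
    0 <= c 0 0 ->
    (forall d, odd d ->
       0 <= (-1) ^+ d./2 * c 0 d -> 0 <= (-1) ^+ d.+1./2 * c 0 d.+1) ->
  forall d, left_half_ge0 c ((-1) ^+ d./2) d.
Proof.
move=> c00_ge0 edge_sign; elim=> [|d c_ge0].
  by move=> j; rewrite leqn0 => /eqP ->; rewrite mul1r.
have half_succ : d.+1./2 = (odd d + d./2)%N by rewrite -uphalf_half.
case: (boolP (odd d)) (edge_sign d) => odd_d edge.
  move: (edge isT (c_ge0 0 isT)); rewrite half_succ odd_d exprS mulN1r.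
  exact: left_half_ge0_even_row.
by rewrite half_succ (negPf odd_d); apply: left_half_ge0_odd_row.
Qed.

End Signs.

Section GTriangle.

Variable a : int.

Lemma cG_diag n : cG a n n = 2 ^- n * aG a n.
Proof. by rewrite /cG big_nat1 !subnn bin0 mulr1. Qed.

Lemma cG_pascal : pascal_rule (cG a).
Proof.
have cGE j d : cG a j d
    = \sum_(j <= k < d.+1) (2 ^- k * aG a k) *+ 'C(d - j, d - k).
  by apply: eq_bigr => k _; rewrite mulrAC mulr_natr.
move=> j d le_jd; rewrite !cGE.
exact: (pascal_rule_binomial_sum (fun k => 2 ^- k * aG a k) le_jd).
Qed.

Lemma cG_left_edge n :
  2 ^+ n * cG a 0 n
    = \sum_(0 <= k < n) aG a k * 'C(n, k)%:R * 2 ^+ (n - k) + aG a n.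
Proof.
rewrite /cG big_nat_recr //= subnn subn0 bin0 mulr1 mulrDr mulrA.
rewrite divff ?expf_neq0 // mul1r mulr_sumr; congr (_ + _).
apply: eq_big_nat => k /andP[_ lt_kn].
by rewrite bin_sub 1?ltnW // expfB //; ring.
Qed.

Lemma cG_edge_rec n : (2 <= n)%N ->
  2 * (cG a n.+1 n.+1 + cG a 0 n.+1) = cG a n n - cG a 0 n.
Proof.
move=> n_ge2; have e_neq0 : 2 ^+ n != 0 :> rat by rewrite expf_neq0.
have diagE p : aG a p = 2 ^+ p * cG a p p.
  by rewrite cG_diag mulrA divff ?mul1r // expf_neq0.
have sumE p : \sum_(0 <= k < p) aG a k * 'C(p, k)%:R * 2 ^+ (p - k)
    = 2 ^+ p * (cG a 0 p - cG a p p).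
  by rewrite mulrBr cG_left_edge -diagE addrK.
have := aG_rec a (n := n.+1) n_ge2; rewrite /= !sumE diagE exprS => rec.
by apply: (mulfI e_neq0); lra.
Qed.

Lemma cG_symmetric : parity_symmetric (cG a).
Proof.
apply: (parity_symmetric_of_edges cG_pascal) => -[_ _|[|d]] //.
  by rewrite (cG_pascal (leqnn 0)) !cG_diag aG0 aG1; lra.
by move=> _ edges; have := cG_edge_rec (n := d.+2) isT; lra.
Qed.

Lemma cG_even_left_edge d : odd d -> (3 <= d)%N ->
  cG a 0 d.+1 = - (cG a 0 d / 2).
Proof.
move=> odd_d d_ge3; have := cG_edge_rec (ltnW d_ge3).
have := cG_symmetric (leq0n d); have := cG_symmetric (leq0n d.+1).
by rewrite !subn0 exprS -signr_odd odd_d; lra.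
Qed.

Hypothesis a_le0 : a <= 0.

Lemma cG_left_half_sign d : left_half_ge0 (cG a) ((-1) ^+ d./2) d.
Proof.
apply: (left_half_sign cG_pascal cG_symmetric); first by rewrite cG_diag aG0.
move=> {}d odd_d; have [d_ge3 | d_lt3] := leqP 3 d.
  by rewrite cG_even_left_edge // -uphalfE uphalf_half odd_d exprS; lra.
have -> : d = 1%N by lia.
have a_leQ0 : a%:~R <= 0 :> rat by rewrite lerz0.
by have := cG_symmetric (leq0n 2); rewrite subn0 cG_diag aG2; lra.
Qed.

Lemma cG_ge0 j d : (j <= d./2)%N -> ~~ odd d./2 -> 0 <= cG a j d.
Proof.
move=> le_jd even_half; have := cG_left_half_sign le_jd.
by rewrite -signr_odd (negPf even_half) mul1r.
Qed.

Lemma cG_le0 j d : (j <= d./2)%N -> odd d./2 -> cG a j d <= 0.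
Proof.
move=> le_jd odd_half; have := cG_left_half_sign le_jd.
by rewrite -signr_odd odd_half mulN1r oppr_ge0.
Qed.

End GTriangle.

Theorem mainTheorem14 (a : int) (ha : a <= -1) (m : nat) (hm : (1 <= m)%N) :
  [/\ 0 <= cG a 0 (4 * m) /\
      (forall j : nat, (j < 2 * m)%N ->
         cG a j (4 * m) <= cG a j.+1 (4 * m)),
      0 <= cG a (2 * m) (4 * m + 1) /\
      (forall j : nat, (j < 2 * m)%N ->
         cG a j.+1 (4 * m + 1) <= cG a j (4 * m + 1)),
      0 >= cG a 0 (4 * m + 2) /\
      (forall j : nat, (j < 2 * m + 1)%N ->
         cG a j (4 * m + 2) >= cG a j.+1 (4 * m + 2))
    & 0 >= cG a (2 * m + 1) (4 * m + 3) /\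
      (forall j : nat, (j < 2 * m + 1)%N ->
         cG a j.+1 (4 * m + 3) >= cG a j (4 * m + 3))].
Proof.
have a_le0 : a <= 0 by apply: le_trans ha _.
split; split; try by [apply: cG_ge0; lia | apply: cG_le0; lia].
- move=> j lt_j; have -> : (4 * m = (4 * m).-1.+1)%N by lia.
  by rewrite (pascal_row_le (@cG_pascal a)) ?cG_le0 //; lia.
- move=> j lt_j; rewrite addn1 (pascal_row_ge (@cG_pascal a)) ?cG_ge0 //; lia.
- move=> j lt_j; rewrite addnS (pascal_row_ge (@cG_pascal a)) ?cG_ge0 //; lia.
- move=> j lt_j; rewrite addnS (pascal_row_le (@cG_pascal a)) ?cG_le0 //; lia.
Qed.
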